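(* Let $\mathcal{A}$ be an $n$-dimensional arrangement of $m$ hyperplanes of rank $r=r(\mathcal{A})$, with characteristic polynomial \[ \chi(\mathcal{A};t)=a_0t^n-a_1t^{n-1}+a_2t^{n-2}+\cdots+(-1)^ra_rt^{n-r}. \] Then \[ \binom{r}{k}\le a_{k}\le \binom{m}{k}\qquad\text{for } 0\le k\le r. \]
   Context: An $n$-dimensional hyperplane arrangement $\mathcal{A}$ is a finite set of (affine, not necessarily through the origin) hyperplanes in an $n$-dimensional vector space $V$. The intersection semi-lattice $L(\mathcal{A})$ is the set of all nonempty intersections $\bigcap_{H\in\mathcal{B}}H$ with $\mathcal{B}\subseteq\mathcal{A}$, including $V=\bigcap_{H\in\emptyset}H$, partially ordered by reverse inclusion; its minimal element is $\hat 0=V$. The rank $r(\mathcal{A})$ is the maximal rank of $L(\mathcal{A})$, equivalently the dimension of the span of the normal vectors of the hyperplanes in $\mathcal{A}$. The characteristic polynomial is $\chi(\mathcal{A};t)=\sum_{X\in L(\mathcal{A})}\mu(\hat 0,X)\,t^{\dim X}$, where $\mu$ is the Möbius function of $L(\mathcal{A})$. *)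

(* Defs.v *)
From HB Require Import structures.
From mathcomp Require Import all_boot all_order all_algebra.
From mathcomp Require Import finmap boolp classical_sets.

Set Implicit Arguments.
Unset Strict Implicit.
Unset Printing Implicit Defensive.

Import Order.TTheory GRing.Theory.

Local Open Scope ring_scope.

Section FinitePoset.
Context {d : Order.disp_t} {T : finPOrderType d}.
Implicit Types (x y z : T) (C : {set T}).

(* The fuel n only has to exceed the number of elements strictly below y;
   mobius_refl, mobius_lt and mobius_nle below are the usual recursion. *)
Fixpoint mobius_rec (n : nat) (x y : T) : int :=
  if n isn't n'.+1 then 0
  else if x == y then 1
  else if (x < y)%O then - \sum_(z | (x <= z < y)%O) mobius_rec n' x z
  else 0.

Definition mobius (x y : T) : int := mobius_rec #|T| x y.

Lemma mobius_rec_stable n m x y :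
  (#|[set z | (z < y)%O]| < n)%N -> (#|[set z | (z < y)%O]| < m)%N ->
  mobius_rec n x y = mobius_rec m x y.
Proof.
elim: n m y => [|n IHn] [|m] y //= ltn ltm.
case: eqP => // _; case: ifP => // _; congr (- _).
apply: eq_bigr => z /andP[_ ltzy].
have lt_card : (#|[set u | (u < z)%O]| < #|[set u | (u < y)%O]|)%N.
  apply: proper_card; apply/properP; split.
    by apply/fintype.subsetP => u; rewrite !inE => /lt_trans; apply.
  by exists z; rewrite !inE ?ltxx.
by apply: IHn; apply: leq_trans lt_card _.
Qed.

Lemma card_below y : (#|[set z | (z < y)%O]| < #|T|)%N.
Proof.
rewrite -cardsT; apply: proper_card; apply/properP; split.
  exact: finset.subsetT.
by exists y; rewrite !inE ?ltxx.
Qed.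

Lemma mobius_refl x : mobius x x = 1.
Proof.
by rewrite /mobius; move: (card_below x); case: #|T| => //= n _; rewrite eqxx.
Qed.

Lemma mobius_lt x y :
  (x < y)%O -> mobius x y = - \sum_(z | (x <= z < y)%O) mobius x z.
Proof.
move=> ltxy; rewrite /mobius.
have ltT := card_below y.
by rewrite (mobius_rec_stable x ltT (leqW ltT)) /= (lt_eqF ltxy) ltxy.
Qed.

Lemma mobius_nle x y : ~~ (x <= y)%O -> mobius x y = 0.
Proof.
move=> nle; rewrite /mobius; case: #|T| => //= n.
case: eqP nle => [->|_]; first by rewrite lexx.
by move=> nle; case: ifP => // /ltW; rewrite (negPf nle).
Qed.

Definition is_chain C : bool := [forall x in C, forall y in C, (x >=< y)%O].

(* A chain with l + 1 elements has length l. *)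
Definition rank_elt x : nat :=
  \max_(C : {set T} | is_chain C && [forall y in C, (y <= x)%O]) #|C|.-1.

Definition poset_rank : nat := \max_(x : T) rank_elt x.

End FinitePoset.

Local Open Scope classical_set_scope.

Section Arrangement.
Context {K : fieldType} {V : vectType K}.
Implicit Types (X H : set V) (A B : {fset (set V)}).

Definition is_hyperplane H : Prop :=
  exists (f : 'Hom(V, K^o)) (c : K), f != 0 /\ H = [set v | f v = c].

Definition is_arrangement A : Prop := forall H, H \in A -> is_hyperplane H.

Definition intersection B : set V := \bigcap_(H in [set` B]) H.

Definition flats A : {fset (set V)} :=
  [fset intersection B | B in fpowerset A & intersection B != set0]%fset.

Lemma flatsP A X :
  reflect (exists B : {fset (set V)},
             [/\ (B `<=` A)%fset, X = intersection B & X !=set0])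
          (X \in flats A).
Proof.
apply: (iffP idP) => [/imfsetP[B /=]|[B [BA XE X0]]].
  by rewrite inE fpowersetE => /andP[BA /set0P B0] ->; exists B.
by apply/imfsetP; exists B => //=; rewrite inE fpowersetE BA; apply/set0P; rewrite -XE.
Qed.

Lemma setT_flats A : [set: V] \in flats A.
Proof.
apply/flatsP; exists fset0; split; [exact: fsub0set| |by exists 0].
by apply/seteqP; split => v // _ H.
Qed.

(* The difference set X - X of a nonempty affine subspace X is its direction;
   adim takes the junk value 0 when X - X is not a linear subspace. *)
Definition direction X : {vspace V} :=
  xget 0%VS [set U : {vspace V} |
    [set v | v \in U] = [set x - y | x in X & y in X]].

Definition adim X : nat := \dim (direction X).

Lemma adim_affine (a : V) (U : {vspace V}) :
  adim [set a + u | u in [set v | v \in U]] = \dim U.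
Proof.
rewrite /adim /direction; congr (\dim _); apply: xget_unique => /=.
  apply/seteqP; split => [v vU|_ [_ [u uU <-] [_ [w wU <-] <-]]] /=.
    exists (a + v); first by exists v.
    exists a; first by exists 0; rewrite ?addr0 //= mem0v.
    by rewrite addrC addKr.
  by rewrite opprD addrACA subrr add0r memvB.
move=> W WE; apply/vspaceP => v.
suff /seteqP[UW WU] : [set v | v \in W] = [set v | v \in U].
  by apply/idP/idP; [apply: UW | apply: WU].
rewrite WE; apply/seteqP; split => [_ [_ [u uU <-] [_ [w wU <-] <-]]|w wU] /=.
  by rewrite opprD addrACA subrr add0r memvB.
exists (a + w); first by exists w.
exists a; first by exists 0; rewrite ?addr0 //= mem0v.
by rewrite addrC addKr.
Qed.

End Arrangement.

Fact flat_display : Order.disp_t. Proof. exact: Order.Disp tt tt. Qed.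

Section IntersectionSemilattice.
Context {K : fieldType} {V : vectType K}.
Variable A : {fset (set V)}.

Definition lattice : Type := flats A.

HB.instance Definition _ := Finite.on lattice.

Implicit Types X Y Z : lattice.

Definition flat_le : rel lattice := fun X Y => `[< val Y `<=` val X >].

Lemma flat_le_refl : reflexive flat_le.
Proof. by move=> X; apply/asboolP. Qed.

Lemma flat_le_anti : antisymmetric flat_le.
Proof.
by move=> X Y /andP[/asboolP YX /asboolP XY]; apply/val_inj/seteqP; split.
Qed.

Lemma flat_le_trans : transitive flat_le.
Proof.
move=> Y X Z /asboolP YX /asboolP ZY.
by apply/asboolP; apply: subset_trans ZY YX.
Qed.

HB.instance Definition _ := Order.Le_isPOrder.Build flat_display lattice
  flat_le_refl flat_le_anti flat_le_trans.

Definition whole_space : lattice := [` setT_flats A]%fset.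

Lemma whole_space_le X : (whole_space <= X)%O.
Proof. by apply/asboolP => v. Qed.

HB.instance Definition _ :=
  Order.hasBottom.Build flat_display lattice whole_space_le.

Definition arr_rank : nat := poset_rank (T := lattice).

Definition char_poly_arr : {poly int} :=
  \sum_(X : lattice) mobius \bot%O X *: 'X^(adim (val X)).

End IntersectionSemilattice.

(* Main.v *)
Require Import Defs.
From mathcomp Require Import all_boot all_order all_algebra.
From mathcomp Require Import finmap boolp classical_sets.

Import Order.TTheory GRing.Theory Num.Theory.
Local Open Scope ring_scope.

(* Number the hyperplanes and call a set B of indices nbc (no broken circuit)
   if no hyperplane H_i contains the intersection of the H_j with j in B, j > i.
   Inverting the sum of (-1)^|B| over the sets B whose hyperplanes all contain
   a flat X shows that mu(0, X) is the sum of (-1)^|B| over the B with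
   intersection X, and a sign-reversing involution cancels the non-nbc ones.
   An nbc set with nonempty intersection has codimension |B|, so a_k is the
   number of these with k elements: at most C(m, k). They are closed under
   taking subsets, and one of them has r elements: at least C(r, k). *)

(** * Sign-reversing involutions on finite sets of indices *)

Section Toggle.
Import boot.fintype boot.finset.
Context {I : finType}.
Implicit Types (B : {set I}) (i : I).

Definition toggle i B : {set I} := if i \in B then B :\ i else i |: B.

Lemma toggleK i : involutive (toggle i).
Proof.
move=> B; rewrite /toggle; case: (boolP (i \in B)) => iB.
  by rewrite setD11 setD1K.
by rewrite setU11 setU1K.
Qed.

Lemma sign_toggle i B : (-1) ^+ #|toggle i B| = - (-1) ^+ #|B| :> int.
Proof.
rewrite /toggle; case: ifPn => iB; last by rewrite cardsU1 iB exprS mulN1r.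
by rewrite [in RHS](cardsD1 i) iB exprS mulN1r opprK.
Qed.

Lemma in_toggle i j B : j != i -> (j \in toggle i B) = (j \in B).
Proof. by move=> ji; rewrite /toggle; case: ifP; rewrite !inE ?ji ?(negPf ji). Qed.

(** The choice [h] survives the toggle, so [B |-> toggle (h B) B] is an involution on [P]. It flips
    every sign, so the sum equals its own opposite. *)
Lemma sum_toggle (P : pred {set I}) (h : {set I} -> I) :
  (forall B, P B -> P (toggle (h B) B) /\ h (toggle (h B) B) = h B) ->
  \sum_(B | P B) (-1) ^+ #|B| = 0 :> int.
Proof.
move=> hP; set S := (X in X = _).
suff SN : S = - S by apply/eqP; rewrite -eqNr -SN.
rewrite {1}/S (reindex_onto (fun B => toggle (h B) B) (fun B => toggle (h B) B)).
  rewrite /S -sumrN; apply: eq_big => [B|B _]; last exact: sign_toggle.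
  apply/andP/idP => [[PB /eqP hB]|PB].
    by rewrite -hB; case: (hP _ PB).
  by have [PtB htB] := hP B PB; rewrite PtB htB toggleK.
by move=> B PB; have [_ ->] := hP B PB; rewrite toggleK.
Qed.

(** Toggling one fixed element of [S] cancels everything; only the empty [S] has no such element. *)
Lemma sum_sign_subsets (S : {set I}) :
  \sum_(B : {set I} | B \subset S) (-1) ^+ #|B| = (S == finset.set0)%:R :> int.
Proof.
have [->|[i iS]] := set_0Vmem S.
  by rewrite eqxx (big_pred1 finset.set0) ?cards0 // => B; rewrite finset.subset0.
have -> : (S == finset.set0) = false by apply/negbTE/set0Pn; exists i.
apply: (sum_toggle _ (fun=> i)) => B BS; split=> //.
by rewrite /toggle; case: ifP => _; [apply: subset_trans (subD1set _ _) BS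
  | rewrite subUset sub1set iS].
Qed.

End Toggle.

(** * Affine geometry of an indexed family of hyperplanes *)

Section HyperplaneFamily.
Context {K : fieldType} {V : vectType K} {m : nat}.
Context (f : 'I_m -> 'Hom(V, K^o)) (c : 'I_m -> K).
Implicit Types (B C : {set 'I_m}) (i j : 'I_m) (X : set V).

Definition hyp i : set V := [set v | f i v = c i]%classic.

Definition inter B : set V := [set v | forall i, i \in B -> f i v = c i]%classic.

(** The direction of [inter B] when that set is nonempty; the definition itself involves no base
    point. *)
Definition inter_dir B : {vspace V} := (\bigcap_(i in B) lker (f i))%VS.

Local Open Scope classical_set_scope.

Lemma interS {B C} : B \subset C -> inter C `<=` inter B.
Proof. by move=> /fintype.subsetP BC v vC i iB; apply/vC/BC. Qed.

Lemma interU1 i B : inter (i |: B) = hyp i `&` inter B.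
Proof.
apply/seteqP; split=> [v vB|v [vi vB] j].
  by split=> [|j jB]; apply: vB; rewrite !inE ?eqxx ?jB ?orbT.
by rewrite !inE => /orP[/eqP ->//|/vB].
Qed.

Lemma mem_inter_dir B (u : V) :
  reflect (forall i, i \in B -> f i u = 0) (u \in inter_dir B).
Proof.
rewrite memvE /inter_dir; apply: (iffP subv_bigcapP) => uB i iB.
  by apply/eqP; rewrite -memv_ker memvE uB.
by rewrite -memvE memv_ker uB.
Qed.

Lemma inter_affine B a : inter B a ->
  inter B = [set a + u | u in [set u | u \in inter_dir B]].
Proof.
move=> aB; apply/seteqP; split=> [v vB|_ [u /mem_inter_dir uB <-] i iB].
  exists (v - a); last by rewrite addrC subrK.
  by apply/mem_inter_dir => i iB; rewrite linearB /= vB // aB // subrr.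
by rewrite linearD /= aB // uB // addr0.
Qed.

Lemma adim_inter B a : inter B a -> adim (inter B) = \dim (inter_dir B).
Proof. by move=> /inter_affine ->; rewrite adim_affine. Qed.

Lemma inter_dir_sub {B C} {a : V} : inter B a -> inter B `<=` inter C ->
  (inter_dir B <= inter_dir C)%VS.
Proof.
move=> aB BC; apply/subvP => u /mem_inter_dir uB; apply/mem_inter_dir => i iC.
have auB : inter B (a + u).
  by rewrite (inter_affine _ _ aB); exists u => //=; apply/mem_inter_dir.
have := BC _ auB i iC; rewrite linearD /= (BC _ aB i iC).
by move/(congr1 (fun x => x - c i)); rewrite addrAC subrr add0r.
Qed.

(** Both sets are translates of their directions by a common point, so nested directions of equal
    dimension would make them equal. *)
Lemma adim_ltn B C : inter B !=set0 -> inter B `<=` inter C ->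
  inter B <> inter C -> (adim (inter B) < adim (inter C))%N.
Proof.
move=> [a aB] BC neq; rewrite (adim_inter _ _ aB) (adim_inter _ _ (BC _ aB)).
have sub := inter_dir_sub aB BC.
rewrite ltn_neqAle dimvS // andbT.
apply/negP => dimE; apply: neq.
rewrite (inter_affine _ _ aB) (inter_affine _ _ (BC _ aB)).
by have /eqP -> : inter_dir B == inter_dir C by rewrite eqEdim sub (eqP dimE) leqnn.
Qed.

(** Rank-nullity for [f i] on [inter_dir B]: the kernel is the new direction and the image is a
    line. *)
Lemma adim_interU1 i B : inter (i |: B) !=set0 -> ~ inter B `<=` hyp i ->
  (adim (inter (i |: B))).+1 = adim (inter B).
Proof.
move=> [a aiB] nsub; have aB := interS (finset.subsetUr _ _) _ aiB.
rewrite (adim_inter _ _ aiB) (adim_inter _ _ aB) -(limg_ker_dim (f i) (inter_dir B)).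
have -> : inter_dir (i |: B) = (inter_dir B :&: lker (f i))%VS.
  apply/vspaceP => u; rewrite memv_cap memv_ker.
  apply/mem_inter_dir/andP => [uB|[/mem_inter_dir uB /eqP ui] j].
    split; last by rewrite uB // finset.setU11.
    by apply/mem_inter_dir => j jB; rewrite uB // inE jB orbT.
  by rewrite !inE => /orP[/eqP->|/uB].
suff -> : \dim (f i @: inter_dir B) = 1%N by rewrite addn1.
apply/eqP; rewrite eqn_leq; apply/andP; split.
  by apply: leq_trans (dimvS (subvf _)) _; rewrite dimvf.
(* A zero image would make [f i] constant on [inter B], equal to its value [c i] at [a]. *)
rewrite lt0n dimv_eq0; apply/negP => /eqP im0; apply: nsub => v.
rewrite (inter_affine _ _ aB) => -[u uB <-].
have : f i u \in (f i @: inter_dir B)%VS by apply: memv_img.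
rewrite im0 memv0 => /eqP fu0.
by rewrite /hyp /= linearD /= fu0 addr0 aiB // finset.setU11.
Qed.

(** The matroid exchange property in affine form. If [y] were off [hyp j], moving [z] parallel to
    [y - x] would reach [inter (j |: B)] without changing the value of [f i], so [z] would lie on
    [hyp i]. *)
Lemma inter_exchange {i j B} : inter (j |: B) !=set0 ->
  inter (j |: B) `<=` hyp i -> ~ inter B `<=` hyp i ->
  inter (i |: B) `<=` hyp j.
Proof.
move=> [x xjB] sub /existsNP[z /not_implyP[zB zi]] y yiB.
apply: contrapT => yj; apply: zi.
have xi := sub _ xjB; have yi : f i y = c i by apply: yiB; rewrite finset.setU11.
have xj : f j x = c j by apply: xjB; rewrite finset.setU11.
have nz : f j y - c j != 0 by rewrite subr_eq0; apply/eqP.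
(* The parameter at which the line through [z] with direction [y - x] meets [hyp j]. *)
pose s : K := (c j - f j z) / (f j y - c j).
have : inter (j |: B) (z + s *: (y - x)).
  rewrite interU1; split=> [|k kB].
    rewrite /hyp /= linearD linearZ linearB /= xj.
    have -> : s *: (f j y - c j : K^o) = s * (f j y - c j) by [].
    by rewrite /s mulfVK // addrC subrK.
  rewrite linearD linearZ linearB /= (zB k kB).
  rewrite (yiB k) ?inE ?kB ?orbT // (xjB k) ?inE ?kB ?orbT //.
  by rewrite subrr scaler0 addr0.
move=> /sub; rewrite /hyp /= linearD linearZ linearB /= yi xi.
by rewrite subrr scaler0 addr0.
Qed.

(** * Sets without broken circuits *)

Definition above i B : {set 'I_m} := [set j in B | (i < j)%N].

(* The case [i \in B] forces B to be independent; the other indices exclude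
   the circuits with their least element removed. *)
Definition nbc B : bool := [forall i, ~~ `[< inter (above i B) `<=` hyp i >]].

Lemma nbcP B : reflect (forall i, ~ inter (above i B) `<=` hyp i) (nbc B).
Proof. by apply: (iffP forallP) => h i; apply/asboolPn. Qed.

Lemma aboveS i {B C} : B \subset C -> above i B \subset above i C.
Proof.
by move=> /fintype.subsetP BC; apply/fintype.subsetP => j;
   rewrite !inE => /andP[/BC -> ->].
Qed.

Lemma nbcS {B C} : B \subset C -> nbc C -> nbc B.
Proof.
move=> BC /nbcP nC; apply/nbcP => i sub; apply: (nC i).
exact: subset_trans (interS (aboveS i BC)) sub.
Qed.

Lemma above_sub i B : above i B \subset B.
Proof. by apply/fintype.subsetP => j; rewrite inE => /andP[]. Qed.

Lemma inter0 : inter finset.set0 = setT.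
Proof. by apply/seteqP; split=> v // _ i; rewrite inE. Qed.

(** Removing the least index [i] leaves exactly [above i B], whose intersection is not inside
    [hyp i] by [nbc]. Each index thus costs one dimension. *)
Lemma adim_nbc B : inter B !=set0 -> nbc B ->
  (adim (inter B) + #|B|)%N = \dim {:V}.
Proof.
have [k] := ubnP #|B|; elim: k B => // k IH B ltk [a aB] nB.
have [B0|[i0 i0B]] := finset.set_0Vmem B.
  rewrite B0 cards0 addn0 (adim_inter _ 0) ?inter0 //.
  by rewrite /inter_dir big_set0.
case: (arg_minnP (fun i : 'I_m => i : nat) i0B) => i iB0 imin.
have {iB0} iB : i \in B := iB0.
have E : B :\ i = above i B.
  apply/finset.setP => j; rewrite !inE andbC; case jB : (j \in B) => //=.
  by rewrite ltn_neqAle (imin j jB) andbT eq_sym.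
rewrite (cardsD1 i) iB add1n addnS -addSn -[in adim _](finset.setD1K iB).
rewrite adim_interU1; first last.
- by rewrite E; move/nbcP: nB; apply.
- by rewrite finset.setD1K //; exists a.
apply: IH; first by rewrite (cardsD1 i) iB in ltk.
  by exists a; apply: interS aB; apply: finset.subD1set.
by apply: nbcS nB; apply: finset.subD1set.
Qed.

Lemma above_toggle i j B : (i <= j)%N -> above j (toggle i B) = above j B.
Proof.
move=> ij; apply/finset.setP => k; rewrite !inE.
have [ki|ki] := eqVneq k i; last by rewrite in_toggle.
by rewrite ki ltnNge ij !andbF.
Qed.

(** The equation of [hyp i] already follows from the members of [B] above [i], and these do not
    change when [i] is added or removed. *)
Lemma inter_toggle {i B} : inter (above i B) `<=` hyp i ->
  inter (toggle i B) = inter B.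
Proof.
move=> sub.
have E C : inter (above i C) `<=` hyp i -> inter (i |: C) = inter C.
  move=> subC; rewrite interU1; apply/seteqP; split=> [v []//|v vC].
  by split=> //; apply: subC; apply: interS vC; apply: above_sub.
rewrite /toggle; case: (boolP (i \in B)) => iB; last exact: E.
rewrite -[in RHS](finset.setD1K iB) E //.
suff -> : above i (B :\ i) = above i B by [].
apply/finset.setP => k; rewrite !inE andbC; case: (eqVneq k i) => [->|_].
  by rewrite ltnn andbF.
by rewrite andbC.
Qed.

(* Toggling the largest index that violates [nbc] changes neither the
   intersection nor that index, so the non-nbc sets cancel in pairs. *)
Lemma sum_nbc X :
  \sum_(B | inter B == X) (-1) ^+ #|B| =
  \sum_(B | (inter B == X) && nbc B) (-1) ^+ #|B| :> int.
Proof.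
rewrite (bigID nbc) /= -[RHS]addr0; congr (_ + _).
(* [i0] is only a default for [pick]; with no index at all, every set is vacuously nbc. *)
have [i0 _|no_i] := pickP (@predT 'I_m); last first.
  rewrite big_pred0 // => B; apply/negbTE; rewrite negb_and negbK.
  by apply/orP; right; apply/forallP => i; have /= := no_i i.
pose bad B i := `[< inter (above i B) `<=` hyp i >].
pose maxbad B i := bad B i && [forall j, bad B j ==> (j <= i)%N].
apply: (sum_toggle _ (fun B => odflt i0 [pick i | maxbad B i])) => B.
case/andP=> /eqP BX; rewrite negb_forall => /existsP[i1 /negPn bad1].
case: pickP => [i /andP[badi /forallP maxi] /=|none]; last first.
  case: (@arg_maxnP _ i1 (bad B) (fun i => i : nat) bad1) => i badi maxi.
  move: (none i); rewrite /maxbad badi => /forallP[] j.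
  by apply/implyP; apply: maxi.
(* Toggling [i] leaves [above j B] unchanged for [j >= i], so [i] remains the largest bad index. *)
have badE j : (i <= j)%N -> bad (toggle i B) j = bad B j.
  by move=> ij; rewrite /bad above_toggle.
split.
  rewrite (inter_toggle (asboolW badi)) BX eqxx /= negb_forall.
  apply/existsP; exists i; rewrite negbK.
  by change (bad (toggle i B) i); rewrite badE.
case: pickP => [j /andP[badj /forallP maxj] /=|/(_ i)]; last first.
  rewrite /maxbad badE // badi /= => /forallP[] j; apply/implyP => badj.
  rewrite leqNgt; apply/negP => ij; move: (ij); rewrite ltnNge => /negP[].
  by move/implyP: (maxi j); apply; rewrite -badE // ltnW.
have ij : (i <= j)%N by move/implyP: (maxj i); apply; rewrite badE.
apply/val_inj/anti_leq; rewrite ij andbT.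
by move/implyP: (maxi j); apply; rewrite -badE.
Qed.

(* The greedy basis of the localization at [inter B], scanning the indices
   upwards. If it were not nbc, exchanging the last needed j > i for i would
   make j redundant. *)
Lemma exists_nbc B : (forall i, ~ setT `<=` hyp i) -> inter B !=set0 ->
  exists C, nbc C /\ inter C = inter B.
Proof.
move=> proper [a aB].
pose S := [set i | `[< inter B `<=` hyp i >]]%SET.
have SP i : reflect (inter B `<=` hyp i) (i \in S) by rewrite inE; apply: asboolP.
have BS : inter S = inter B.
  apply/seteqP; split=> [v vS i iB|v vB i /SP]; last by apply.
  by apply: vS; apply/SP => w; apply.
pose below i := [set j in S | (j < i)%N]%SET.
pose C := [set i in S | ~~ `[< inter (below i) `<=` hyp i >]]%SET.
have CS : C \subset S by apply/fintype.subsetP => i; rewrite inE => /andP[].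
exists C; split; last first.
  rewrite -BS; apply/seteqP; split; last exact: interS.
  move=> v vC.
  (* Induction on the index: an element of [S] left out of [C] is implied by the smaller elements of
     [S]. *)
  suff vS (k : nat) i : (i < k)%N -> i \in S -> f i v = c i.
    by move=> i; apply: vS (ltn_ord i).
  elim: k i => // k IH i ik iS; case: (boolP (i \in C)) => [/vC//|].
  rewrite inE iS negbK => /asboolP; apply=> j.
  by rewrite inE => /andP[jS ji]; apply: IH => //; apply: leq_trans ji _.
apply/nbcP => i sub.
have iS : i \in S.
  apply/SP; rewrite -BS; apply: subset_trans sub; apply: interS.
  by apply: fintype.subset_trans (above_sub _ _) CS.
pose W (k : nat) := [set j in above i C | (j < k)%N]%SET.
have exW : exists k, `[< inter (W k) `<=` hyp i >].
  exists m; apply/asboolP; suff -> : W m = above i C by [].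
  by apply/finset.setP => j; rewrite [in LHS]inE ltn_ord andbT.
case: (ex_minnP exW) => -[|k] /asboolP subW minW.
  apply: (proper i); rewrite -inter0; move: subW; congr (inter _ `<=` _).
  by apply/finset.setP => j; rewrite !inE ltn0 andbF.
have nW : ~ inter (W k) `<=` hyp i.
  by move=> subk; have := minW k (asboolT subk); rewrite ltnn.
(* By minimality, passing from [W k] to [W k.+1] must add an element, which can only be [k]. *)
have [j jC jk] : exists2 j, j \in above i C & j = k :> nat.
  apply: contrapT => noj; apply: nW; suff -> : W k = W k.+1 by [].
  apply/finset.setP => j; rewrite [LHS]inE [RHS]inE ltnS (leq_eqVlt j k).
  case: (eqVneq (j : nat) k) => //= jk.
  by case: (boolP (j \in above i C)) => // jC; case: noj; exists j.
have WS : W k.+1 = j |: W k.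
  apply/finset.setP => l; rewrite [LHS]inE finset.in_setU1 [in RHS]inE.
  rewrite ltnS (leq_eqVlt l k) -jk val_eqE.
  by case: (eqVneq l j) => [->|_] //=; rewrite jC.
have WsubS l : W l \subset S.
  apply: fintype.subset_trans CS; apply: fintype.subset_trans (above_sub i _).
  by apply/fintype.subsetP => x; rewrite inE => /andP[].
move: (jC); rewrite inE => /andP[]; rewrite inE => /andP[jS] /asboolPn nj ij; apply: nj.
rewrite WS in subW.
(* After the exchange [hyp j] is forced by [i |: W k], which lies in [S] below [j]; this contradicts
   [j \in C]. *)
apply: subset_trans (inter_exchange _ subW nW).
  apply: interS; apply/fintype.subsetP => l; rewrite !inE => /predU1P[->|].
    by rewrite ij andbT; apply/asboolP/SP.
  move=> /andP[/andP[/andP[-> _] _] lk]; by rewrite jk.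
by exists a; rewrite -WS; apply: (interS (WsubS _)); rewrite BS.
Qed.

End HyperplaneFamily.

(** * The Möbius function as a signed count of index sets *)

Section Lattice.
Context {K : fieldType} {V : vectType K} {m : nat}.
Context (f : 'I_m -> 'Hom(V, K^o)) (c : 'I_m -> K) (A : {fset (set V)}).
Context (f_neq0 : forall i, f i != 0).
Context (A_hyp : forall H, (H \in A) <-> exists i, H = hyp f c i).
Implicit Types (B C : {set 'I_m}) (X Y Z : lattice A).

Local Notation hyp := (hyp f c).
Local Notation inter := (inter f c).
Local Notation nbc := (nbc f c).
Local Open Scope classical_set_scope.

Definition central B : bool := `[< inter B !=set0 >].

Lemma flat_inter (X : set V) :
  X \in flats A <-> exists B, X = inter B /\ X !=set0.
Proof.
split=> [/flatsP[G [GA XE X0]]|[B [XE X0]]].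
  exists [set i | hyp i \in G]%SET; split=> //; rewrite XE.
  apply/seteqP; split=> [v vG i|v vB H /= HG].
    by rewrite inE => iG; apply: (vG (hyp i)).
  have /A_hyp[i HE] := fsubsetP GA H HG.
  by rewrite HE; apply: vB; rewrite inE -HE.
apply/flatsP; exists [fset hyp i | i in B]%fset; split=> //.
  by apply/fsubsetP => _ /imfsetP[i _ ->]; apply/A_hyp; exists i.
rewrite XE; apply/seteqP; split=> [v vB _ /= /imfsetP[i iB ->]|v vG i iB].
  exact: vB.
by apply: (vG (hyp i)); apply/imfsetP; exists i.
Qed.

Lemma hyp_proper i : ~ setT `<=` hyp i.
Proof.
move=> sub; have /eqP := f_neq0 i; apply; apply/lfunP => v.
have fE w : f i w = c i := sub w I.
by rewrite fE -(fE 0) linear0 lfunE.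
Qed.

(* The junk value of [flat] on a non-central set is the whole space. *)
Definition flat B : lattice A :=
  insubd (whole_space A : flats A) (inter B).

Lemma val_flat B : central B -> val (flat B) = inter B.
Proof.
move=> /asboolP B0; rewrite /flat insubdK //.
by apply/flat_inter; exists B.
Qed.

Lemma lattice_inter X : exists B, [/\ val X = inter B, central B & flat B = X].
Proof.
have /flat_inter[B [XE X0]] := valP X.
have B0 : central B by apply/asboolP; rewrite -XE.
by exists B; split=> //; apply: val_inj; rewrite val_flat.
Qed.

Lemma eq_flat B X : central B -> (flat B == X) = (inter B == val X).
Proof. by move=> B0; rewrite -val_eqE val_flat. Qed.

Lemma inter_central B X : inter B == val X -> central B.
Proof.
move=> /eqP BX; apply/asboolP; rewrite BX.
by have [C [-> /asboolP]] := lattice_inter X.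
Qed.

(** The index sets collected here are the subsets of [S], the hyperplanes containing [X]. Their
    signed sum vanishes unless [S] is empty, which happens only for the whole space. *)
Lemma sum_flat_le X :
  \sum_(Y | (Y <= X)%O) \sum_(B | inter B == val Y) (-1) ^+ #|B|
  = (X == \bot%O)%:R :> int.
Proof.
pose S := [set i | `[< val X `<=` hyp i >]]%SET.
have subS B : (B \subset S) = `[< val X `<=` inter B >].
  apply/fintype.subsetP/asboolP => [BS v vX i iB|XB i iB].
    by have := BS i iB; rewrite inE => /asboolP; apply.
  by rewrite inE; apply/asboolP => v /XB; apply.
have [D [XD /asboolP[x xD] _]] := lattice_inter X.
have centS B : B \subset S -> central B.
  by rewrite subS => /asboolP XB; apply/asboolP; exists x; apply: XB; rewrite XD.
transitivity (\sum_(B : {set 'I_m} | B \subset S) (-1) ^+ #|B| : int).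
  rewrite [RHS](partition_big flat (fun Y => (Y <= X)%O)) /=; last first.
    move=> B BS; apply/asboolP; rewrite val_flat ?centS //.
    by apply/asboolP; rewrite -subS.
  apply: eq_bigr => Y /asboolP XY; apply: eq_bigl => B.
  apply/idP/andP => [BY|[BS]]; last by rewrite eq_flat ?centS.
  rewrite eq_flat ?(inter_central _ Y) //; split=> //.
  by rewrite subS (eqP BY); apply/asboolP.
rewrite sum_sign_subsets; congr ((nat_of_bool _)%:R).
apply/eqP/eqP => [S0|X0].
  apply: val_inj; apply/seteqP; split=> // v _; rewrite XD => i iD.
  have : i \in S by rewrite inE XD; apply/asboolP => w; apply.
  by rewrite S0 inE.
apply/finset.setP => i; rewrite !inE; apply/asboolPn; rewrite X0.
exact: hyp_proper.
Qed.

(** By [sum_flat_le] the right-hand side satisfies the recursion defining [mobius]; the induction is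
    on the number of flats strictly below [X]. *)
Lemma mobius_sum X :
  mobius \bot%O X = \sum_(B | inter B == val X) (-1) ^+ #|B|.
Proof.
have [k] := ubnP #|[set Z : lattice A | (Z < X)%O]%SET|.
elim: k X => // k IH X ltk.
have := sum_flat_le X; rewrite (bigD1 X) //=.
under [X in _ + X = _]eq_bigl => Y do rewrite andbC -lt_neqAle.
have [->|X0] := eqVneq X \bot%O.
  rewrite mobius_refl [X in _ + X]big_pred0 ?addr0 => [->//|Y].
  by rewrite ltx0.
rewrite mobius_lt ?lt0x // => /eqP.
rewrite addr_eq0 => /eqP ->; congr (- _).
apply: eq_big => [Y|Y /andP[_ YX]]; first by rewrite le0x.
apply: IH; rewrite ltnS in ltk; apply: leq_trans ltk; apply: proper_card.
apply/fintype.properP; split.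
  by apply/fintype.subsetP => Z; rewrite !inE => /lt_trans; apply.
by exists Y; rewrite !inE ?ltxx.
Qed.

(** Grouping nbc sets by their flat [X] works because all of them have the codimension of [X] as
    cardinality. *)
Lemma char_poly_nbc :
  char_poly_arr A =
  \sum_(B | nbc B && central B) (-1) ^+ #|B| *: 'X^(\dim {:V} - #|B|).
Proof.
rewrite (partition_big flat predT) //; apply: eq_bigr => X _.
rewrite mobius_sum sum_nbc scaler_suml; apply: eq_big => [B|B /andP[BX nB]].
  rewrite -andbA; apply/andP/and3P => [[BX nB]|[nB cB]].
    by rewrite nB eq_flat ?(inter_central _ X).
  by rewrite eq_flat // => BX.
have /asboolP B0 := inter_central _ _ BX.
by rewrite -(adim_nbc _ _ B B0 nB) addnK (eqP BX).
Qed.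

(** * Chains of flats and the rank *)

Lemma adim_lt {X Y} : (X < Y)%O -> (adim (val Y) < adim (val X))%N.
Proof.
rewrite lt_neqAle => /andP[XY /asboolP YX].
have [B [XB /asboolP B0 _]] := lattice_inter X.
have [C [YC /asboolP C0 _]] := lattice_inter Y.
rewrite XB YC; apply: adim_ltn => //; first by rewrite -XB -YC.
by rewrite -XB -YC => /val_inj YX'; rewrite YX' eqxx in XY.
Qed.

Lemma centralS {B C} : B \subset C -> central C -> central B.
Proof. by move=> BC /asboolP[v vC]; apply/asboolP; exists v; apply: interS vC. Qed.

(** Deleting the indices one by one gives a chain of flats down to the whole space; [adim_nbc] makes
    every step strict. *)
Lemma nbc_chain B : nbc B -> central B ->
  exists D : {set lattice A},
    [/\ is_chain D, forall Y, Y \in D -> (Y <= flat B)%O & #|D| = #|B|.+1].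
Proof.
have [k] := ubnP #|B|; elim: k B => // k IH B ltk nB cB.
have [B0|[i iB]] := finset.set_0Vmem B.
  exists [set flat B]%SET; rewrite finset.cards1 B0 finset.cards0; split=> //.
    by apply/forall_inP => Y /set1P ->;
      apply/forall_inP => Z /set1P ->; apply: comparablexx.
  by move=> Y /set1P ->.
have sB : B :\ i \subset B := finset.subD1set B i.
have [|D [chD leD cardD]] := IH (B :\ i) _ (nbcS _ _ sB nB) (centralS sB cB).
  by rewrite (cardsD1 i) iB in ltk.
have lt_flat : (flat (B :\ i) < flat B)%O.
  rewrite lt_neqAle; apply/andP; split; last first.
    by apply/asboolP; rewrite !val_flat ?(centralS sB) //; apply: interS.
  apply/negP => /eqP /(congr1 (fun X => adim (val X))).
  rewrite !val_flat ?(centralS sB) // => E.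
  have /asboolP B0 := cB; have /asboolP Bi0 := centralS sB cB.
  have := adim_nbc _ _ B B0 nB; rewrite -(adim_nbc _ _ _ Bi0 (nbcS _ _ sB nB)) E.
  by move/addnI; rewrite (cardsD1 i B) iB => /eqP; rewrite add1n eqn_leq ltnn.
have leB Y : Y \in D -> (Y < flat B)%O by move=> /leD YB; apply: le_lt_trans lt_flat.
exists (flat B |: D); split.
- apply/forall_inP => Y /setU1P YD; apply/forall_inP => Z /setU1P ZD.
  case: YD ZD => [->|YD] [->|ZD]; first exact: comparablexx.
  + by rewrite comparable_sym lt_comparable ?leB.
  + by rewrite lt_comparable ?leB.
  + by have /forall_inP/(_ _ YD)/forall_inP/(_ _ ZD) := chD.
- by move=> Y /setU1P[->//|/leB/ltW].
- rewrite cardsU1 cardD (cardsD1 i B) iB add1n.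
  by case: (boolP (flat B \in D)) => // /leB; rewrite ltxx.
Qed.

Lemma nbc_le_rank B : nbc B -> central B -> (#|B| <= arr_rank A)%N.
Proof.
move=> nB cB; have [D [chD leD cardD]] := nbc_chain B nB cB.
apply: leq_trans (leq_bigmax (flat B)).
have -> : #|B| = #|D|.-1 by rewrite cardD.
by apply: leq_bigmax_cond; rewrite chD; apply/forall_inP.
Qed.

Lemma adim_flat_le X : (adim (val X) <= \dim {:V})%N.
Proof.
have [B [-> /asboolP[v vB] _]] := lattice_inter X.
by rewrite (adim_inter _ _ _ _ vB) dimvS ?subvf.
Qed.

(** A flat [Y] of maximal codimension is the intersection of an nbc set of [codim Y] elements, and
    no chain is longer than [codim Y]. *)
Lemma nbc_rank : exists B, [/\ nbc B, central B & #|B| = arr_rank A].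
Proof.
pose codim X := (\dim {:V} - adim (val X))%N.
have [|Y YE] := bigop.eq_bigmax codim; first by apply/card_gt0P; exists \bot%O.
have rank_le : (arr_rank A <= codim Y)%N.
  apply/bigmax_leqP => X _; apply/bigmax_leqP => D /andP[chD _].
  (* Codimension is injective on a chain with values from [0] to [codim Y], so the chain has at most
     [codim Y + 1] elements. *)
  rewrite -subn1 leq_subLR add1n.
  pose g X : 'I_(codim Y).+1 := inord (codim X).
  rewrite -[leqRHS]card_ord -(@card_in_imset _ _ g D) ?max_card //.
  have codim_lt Z1 Z2 : (Z1 < Z2)%O -> (codim Z1 < codim Z2)%N.
    move=> lt12; rewrite ltn_sub2l //; last exact: adim_lt.
    exact: leq_trans (adim_lt lt12) (adim_flat_le _).
  move=> Z1 Z2 D1 D2 /(congr1 val); rewrite /= !inordK ?ltnS -?YE ?leq_bigmax //.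
  have /forall_inP/(_ _ D1)/forall_inP/(_ _ D2) := chD.
  by case: comparableP => // /codim_lt lt12 _ E; rewrite E ltnn in lt12.
have [B [YB /asboolP B0 _]] := lattice_inter Y.
have [C [nC CE]] := exists_nbc _ _ B hyp_proper B0.
have C0 : inter C !=set0 by rewrite CE.
have cC : central C by apply/asboolP.
exists C; split=> //; apply/eqP; rewrite eqn_leq nbc_le_rank //=.
by apply: leq_trans rank_le _; rewrite /codim YB -CE -(adim_nbc _ _ C C0 nC) addKn.
Qed.

(** * Coefficients of the characteristic polynomial *)

Lemma arr_rank_le_dim : (arr_rank A <= \dim {:V})%N.
Proof.
have [B [nB /asboolP B0 <-]] := nbc_rank.
by rewrite -(adim_nbc _ _ B B0 nB) leq_addl.
Qed.

(** The unsigned Whitney numbers of the first kind of the lattice. *)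
Definition nbc_count k :=
  #|[set B : {set 'I_m} | (nbc B && central B) && (#|B| == k)]%SET|.

Lemma char_poly_nbc_count :
  char_poly_arr A = \sum_(k < (arr_rank A).+1)
    ((-1) ^+ k * (nbc_count k)%:Z) *: 'X^(\dim {:V} - k).
Proof.
rewrite char_poly_nbc.
(* [inord] is faithful here, as a central nbc set has at most [arr_rank A] elements. *)
rewrite (partition_big (fun B => inord #|B| : 'I_(arr_rank A).+1) predT) //=.
apply: eq_bigr => k _; rewrite -natz mulr_natr -scalerMnl -sumr_const.
apply: eq_big => [B|B /andP[/andP[nB cB] /eqP <-]]; last first.
  by rewrite inordK // ltnS nbc_le_rank.
rewrite inE; case: (boolP (nbc B && central B)) => //= /andP[nB cB].
by rewrite -val_eqE /= inordK // ltnS nbc_le_rank.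
Qed.

Lemma coef_char_poly k : (k <= arr_rank A)%N ->
  (char_poly_arr A)`_(\dim {:V} - k) = (-1) ^+ k * (nbc_count k)%:Z.
Proof.
move=> kr; have kr' : (k < (arr_rank A).+1)%N by [].
rewrite char_poly_nbc_count coef_sum (bigD1 (Ordinal kr')) //=.
rewrite coefZ coefXn eqxx mulr1 big1 ?addr0 // => j jk.
rewrite coefZ coefXn; case: eqP => [E|]; last by rewrite mulr0.
case/eqP: jk; apply: val_inj => /=.
(* The truncated subtraction [\dim {:V} - l] is injective for [l] up to the dimension, so only one
   term contributes. *)
have le_dim l : (l <= arr_rank A)%N -> (l <= \dim {:V})%N.
  by move/leq_trans; apply; apply: arr_rank_le_dim.
by rewrite -(subKn (le_dim j _)) -?E ?subKn ?le_dim // -ltnS.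
Qed.

Lemma nbc_count_le k : (nbc_count k <= 'C(m, k))%N.
Proof.
rewrite -[in leqRHS](card_ord m) -card_draws subset_leq_card //.
by apply/fintype.subsetP => B; rewrite !inE => /andP[].
Qed.

Lemma nbc_count_ge k : ('C(arr_rank A, k) <= nbc_count k)%N.
Proof.
have [C [nC cC <-]] := nbc_rank; rewrite -cards_draws subset_leq_card //.
apply/fintype.subsetP => B; rewrite !inE => /andP[BC ->].
by rewrite (nbcS _ _ BC nC) (centralS BC cC).
Qed.

End Lattice.

(** * Transfer from numbered equations to the arrangement *)

Theorem corollary2p4 (K : fieldType) (V : vectType K) (A : {fset (set V)})
    (n m r : nat) (a : nat -> int) :
  is_arrangement A ->
  \dim (fullv : {vspace V}) = n ->
  #|` A| = m ->
  arr_rank A = r ->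
  (forall k : nat, (k <= r)%N ->
     a k = (-1) ^+ k * (char_poly_arr A)`_(n - k)) ->
  char_poly_arr A = \sum_(k < r.+1) ((-1) ^+ k * a k) *: 'X^(n - k) /\
  (forall k : nat, (k <= r)%N ->
     ('C(r, k)%:Z <= a k) /\ (a k <= 'C(m, k)%:Z)).
Proof.
move=> arrA <- <- <- aE.
(* Hyperplanes are numbered by their position in [A], and an equation is chosen for each. *)
have [|fc fcP] := @choice 'I_#|` A| ('Hom(V, K^o) * K) (fun i g =>
    g.1 != 0 /\ nth classical_sets.set0 A i = [set v | g.1 v = g.2]%classic).
  move=> i; have [|f [c [f0 HE]]] := arrA (nth classical_sets.set0 A i).
    by rewrite mem_nth.
  by exists (f, c).
pose f i := (fc i).1; pose c i := (fc i).2.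
have f_neq0 i : f i != 0 by case: (fcP i).
have A_hyp H : (H \in A) <-> exists i, H = hyp f c i.
  split=> [HA|[i ->]].
    have iA : (index H A < #|` A|)%N by rewrite index_mem.
    exists (Ordinal iA); have [_] := fcP (Ordinal iA).
    by rewrite nth_index.
  by have [_ E] := fcP i; rewrite -[hyp _ _ _]E mem_nth.
have aE' k : (k <= arr_rank A)%N -> a k = (nbc_count f c k)%:Z.
  by move=> kr; rewrite aE // (coef_char_poly f c A f_neq0 A_hyp) // signrMK.
split=> [|k kr].
  rewrite (char_poly_nbc_count f c A f_neq0 A_hyp); apply: eq_bigr => k _.
  by rewrite aE' // -ltnS.
rewrite aE' // !lez_nat nbc_count_le; split=> //.
exact: nbc_count_ge f_neq0 A_hyp k.
Qed.
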